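(* For every integer $n\ge 0$, the central trinomial coefficient $c_n$ is the value at $(1,1)$ of the hybrid Hermite-Laguerre polynomial $\Pi_n(x,y)$: $$c_n=\Pi_n(1,1).$$
   Context: For integers $n\ge 0$, the central trinomial coefficients are $$c_n=\sum_{k=0}^{\lfloor n/2\rfloor}\frac{n!}{(k!)^2\,(n-2k)!}$$ (equivalently, $c_n$ is the coefficient of $x^n$ in $(1+x+x^2)^n$). The Hermite-Kampé de Fériet polynomials are $$H_n(x,y)=n!\sum_{k=0}^{\lfloor n/2\rfloor}\frac{x^{n-2k}y^k}{k!\,(n-2k)!}.$$ The inverse derivative operator $\widehat{D}_x^{-1}$ acts on functions of $x$ by $\widehat{D}_x^{-k}f(x)=\frac{1}{(k-1)!}\int_0^x (x-\xi)^{k-1}f(\xi)\,d\xi$ for $k\ge 1$ and $\widehat{D}_x^{0}f=f$; in particular, on the constant function $\mathbf 1$ one has $\widehat{D}_x^{-k}\mathbf 1=x^k/k!$ for $k\ge 0$. The hybrid Hermite-Laguerre polynomials are defined by $$\Pi_n(x,y)=H_n(y,\widehat{D}_x^{-1})\mathbf 1,$$ that is, the second argument of $H_n$ is replaced by the operator $\widehat{D}_x^{-1}$ (which commutes with multiplication by $y$), and the resulting operator is applied to $\mathbf 1$. *)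

(* Defs.v *)
From HB Require Import structures.
From mathcomp Require Import all_boot all_order all_algebra.
From mathcomp Require Import all_classical all_reals all_analysis.

Set Implicit Arguments.
Unset Strict Implicit.
Unset Printing Implicit Defensive.

Import Order.TTheory GRing.Theory Num.Theory.
Import numFieldNormedType.Exports.

Local Open Scope classical_set_scope.
Local Open Scope ring_scope.

Definition central_trinomial (R : numFieldType) (n : nat) : R :=
  \sum_(k < n./2.+1) (n`!)%:R / ((k`!)%:R ^+ 2 * ((n - k.*2)`!)%:R).

(* H_n(x, y) as a formal polynomial in y (outer indeterminate) with
   coefficients in R[x] (inner indeterminate), so that an operator can be
   substituted for y; see [hermite_kdfE] for its values on scalars. *)
Definition hermite_kdf (R : numFieldType) (n : nat) : {poly {poly R}} :=
  (n`!)%:R *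
  \sum_(k < n./2.+1)
     ((((k`!)%:R * ((n - k.*2)`!)%:R)^-1 *: 'X^(n - k.*2))%:P * 'X^k).

Lemma hermite_kdfE (R : numFieldType) (n : nat) (x y : R) :
  (hermite_kdf R n).[y%:P].[x] =
  (n`!)%:R * \sum_(k < n./2.+1)
     (x ^+ (n - k.*2) * y ^+ k) / ((k`!)%:R * ((n - k.*2)`!)%:R).
Proof.
rewrite /hermite_kdf hornerM -(polyC_natr {poly R}) hornerC hornerM.
rewrite -(polyC_natr R) hornerC; congr (_ * _).
rewrite !horner_sum; apply: eq_bigr => k _.
rewrite hornerM hornerC hornerXn -polyC_exp hornerM hornerC hornerZ hornerXn.
by rewrite [RHS]mulrC mulrA.
Qed.

(* Integral from 0 to x with the usual orientation: for x < 0 it is the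
   opposite of the integral over [x, 0]. *)
Definition integral_from0 (R : realType) (g : R -> R) (x : R) : R :=
  if 0 <= x then \int[lebesgue_measure]_(t in `[0, x]) g t
  else - \int[lebesgue_measure]_(t in `[x, 0]) g t.

(* [inv_derive k] is the k-th power of the inverse derivative operator. *)
Definition inv_derive (R : realType) (k : nat) (f : R -> R) : R -> R :=
  if k is j.+1 then
    fun x => (j`!)%:R^-1 * integral_from0 (fun xi => (x - xi) ^+ j * f xi) x
  else f.

(* Substitution in P(u, v) of the scalar y for u (inner indeterminate) and of
   an operator for v (outer indeterminate); the operator is given by the
   family [A] of its powers, and the result is applied to f. *)
Definition subst_op (R : realType) (P : {poly {poly R}}) (y : R)
    (A : nat -> (R -> R) -> (R -> R)) (f : R -> R) : R -> R :=
  fun x => \sum_(k < size P) (P`_k).[y] * A k f x.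

Definition hermite_laguerre (R : realType) (n : nat) (x y : R) : R :=
  subst_op (hermite_kdf R n) y (@inv_derive R) (fun=> 1) x.

(* Main.v *)
Require Import Defs.
From mathcomp Require Import all_boot all_order all_algebra.
From mathcomp Require Import all_classical all_reals all_analysis.
From mathcomp Require Import ring.

Import Order.TTheory GRing.Theory Num.Theory.
Import numFieldNormedType.Exports.

Local Open Scope ring_scope.

(** Applying the k-th power of the inverse derivative to the constant 1 gives
    x^k / k! ([inv_derive_cst1]), by the fundamental theorem of calculus applied
    to a polynomial primitive of (x - t)^(k - 1).  Substituting the operator for
    the second variable of H_n therefore contributes a second factor 1 / k! to
    its k-th term, so that Pi_n(x, y) is the sum of the
    n! y^(n - 2k) x^k / (k!^2 (n - 2k)!) ([hermite_laguerreE]).  At x = y = 1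
    this is the sum defining the central trinomial coefficient. *)

Lemma Rintegral_deriv (R : realType) (p : {poly R}) (a b : R) : a <= b ->
  \int[lebesgue_measure]_(t in `[a, b]) (p^`()).[t] = p.[b] - p.[a].
Proof.
rewrite le_eqVlt => /predU1P[->|ab].
  by rewrite set_itv1 Rintegral_set1 subrr.
rewrite /Rintegral (@continuous_FTC2 _ _ (horner p)) //.
- by apply: continuous_subspaceT => t; exact: continuous_horner.
- split.
  + by move=> t _; exact: derivable_horner.
  + by apply: cvg_at_right_filter; exact: continuous_horner.
  + by apply: cvg_at_left_filter; exact: continuous_horner.
- by move=> t _; rewrite -derivE.
Qed.

Lemma integral_from0_deriv (R : realType) (p : {poly R}) (x : R) :
  integral_from0 (fun t => (p^`()).[t]) x = p.[x] - p.[0].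
Proof.
rewrite /integral_from0; case: leP => [x0|/ltW x0].
  exact: Rintegral_deriv.
by rewrite Rintegral_deriv// opprB.
Qed.

(** Each k > 0 needs a single integration, since the operator power is given by
    Cauchy's formula for repeated integration; no induction on k is involved. *)
Lemma inv_derive_cst1 (R : realType) (k : nat) (x : R) :
  inv_derive k (fun=> 1) x = x ^+ k / (k`!)%:R.
Proof.
case: k => [|j] /=; first by rewrite expr0 fact0 divr1.
have j1 : j.+1%:R != 0 :> R by rewrite pnatr_eq0.
(* A primitive of (x - t) ^+ j; the sign turns the powers of t - x, whose formal
   derivative is immediate, into those of x - t. *)
pose p : {poly R} := ((-1) ^+ j / j.+1%:R) *: ('X - x%:P) ^+ j.+1.
have -> : (fun t => (x - t) ^+ j * 1) = (fun t => (p^`()).[t]).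
  apply/funext => t; rewrite derivZ deriv_exp derivXsubC mul1r !hornerE.
  rewrite hornerMn !hornerE -[_ ^+ _ *+ _]mulr_natr mulrACA mulVf// mulr1.
  by rewrite -exprMn mulN1r opprB.
rewrite integral_from0_deriv !hornerE subrr expr0n/= mulr0 !sub0r.
rewrite -mulrN.
have -> : - (- x) ^+ j.+1 = (-1) ^+ j * x ^+ j.+1.
  by rewrite [in LHS]exprNn exprS mulN1r mulNr opprK.
rewrite mulrACA -expr2 sqrr_sign mul1r.
by rewrite factS natrM invfM mulrA mulrC [_^-1 * _ in LHS]mulrC.
Qed.

Lemma coef_hermite_kdf (R : numFieldType) (n k : nat) :
  (hermite_kdf R n)`_k =
  if (k < n./2.+1)%N
  then ((n`!)%:R / ((k`!)%:R * ((n - k.*2)`!)%:R)) *: 'X^(n - k.*2) else 0.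
Proof.
rewrite /hermite_kdf -(polyC_natr {poly R}) coefCM coef_sum.
under eq_bigr => i _ do rewrite coefCM coefXn.
case: ifPn => [kn|nk].
  rewrite (bigD1 (Ordinal kn))//= eqxx mulr1 big1 ?addr0.
    by rewrite -scalerA scaler_nat mulr_natl.
  move=> i ik; case: eqP => [ki|]; last by rewrite mulr0.
  by case/eqP: ik; exact/val_inj.
rewrite big1 ?mulr0// => i _; case: eqP => [ki|]; last by rewrite mulr0.
by rewrite ki ltn_ord in nk.
Qed.

Lemma hermite_laguerreE (R : realType) (n : nat) (x y : R) :
  hermite_laguerre n x y =
  \sum_(k < n./2.+1)
     (n`!)%:R * (y ^+ (n - k.*2) * x ^+ k) /
     ((k`!)%:R ^+ 2 * ((n - k.*2)`!)%:R).
Proof.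
rewrite /hermite_laguerre /subst_op.
set P := hermite_kdf R n.
pose F k := (P`_k).[y] * inv_derive k (fun=> 1) x.
have sizeP : (size P <= n./2.+1)%N.
  by apply/leq_sizeP => k nk; rewrite coef_hermite_kdf ltnNge nk.
(* The sum can be extended because the coefficients vanish from [size P] on. *)
have -> : \sum_(k < size P) (P`_k).[y] * inv_derive k (fun=> 1) x =
          \sum_(k < n./2.+1) F k.
  rewrite (big_ord_widen _ F sizeP) big_mkcond/=; apply: eq_bigr => k _.
  by case: ltnP => // kP; rewrite /F nth_default// horner0 mul0r.
apply: eq_bigr => k _.
rewrite /F coef_hermite_kdf ltn_ord hornerZ hornerXn inv_derive_cst1.
rewrite expr2 !invfM; ring.
Qed.

Theorem proposition6 (R : realType) (n : nat) :
  central_trinomial R n = hermite_laguerre n (1 : R) (1 : R).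
Proof.
rewrite hermite_laguerreE; apply: eq_bigr => k _.
by rewrite !expr1n !mulr1.
Qed.
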